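(* For every $D\ge3$ there is no graph of degree $3$, diameter $D$ and cyclic defect. Furthermore, for every odd $g\ge5$ there is no graph of degree $3$, girth $g$ and cyclic excess.
   Context: For an integer $d\ge 1$ define polynomials $G_{d,m}(x)$ by $G_{d,0}(x)=1$, $G_{d,1}(x)=x+1$, and $G_{d,m+1}(x)=xG_{d,m}(x)-(d-1)G_{d,m-1}(x)$ for $m\ge1$. Let $J_n$ be the $n\times n$ all-ones matrix. For a graph on $n\ge3$ vertices, a cycle matrix is the adjacency matrix $B$ of an $n$-cycle on the same vertex set (i.e., for some ordering $v_1,\dots,v_n$ of the vertices, $B_{ij}=1$ iff $v_i,v_j$ are cyclically consecutive, and $0$ otherwise); this cycle need not consist of edges of the graph. A graph $\Gamma$ of order $n$ with adjacency matrix $A$ is a graph of degree $d$, diameter $D$ and cyclic defect if $\Gamma$ is $d$-regular with $d\ge3$, has diameter $D\ge2$, and $G_{d,D}(A)=J_n+B$ for some cycle matrix $B$. It is a graph of degree $d$, girth $g$ and cyclic excess if $\Gamma$ is $d$-regular with $d\ge3$, has odd girth $g\ge5$, and $G_{d,\lfloor g/2\rfloor}(A)=J_n-B$ for some cycle matrix $B$. *)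

(* Defs.v *)
From HB Require Import structures.
From mathcomp Require Import all_boot all_order all_fingroup all_algebra.

Set Implicit Arguments.
Unset Strict Implicit.
Unset Printing Implicit Defensive.

Import GRing.Theory.
Local Open Scope ring_scope.

Record sgraph := SGraph {
  vertex :> finType;
  adj : rel vertex;
  adj_sym : symmetric adj;
  adj_irr : irreflexive adj }.

Definition regular (G : sgraph) (d : nat) : Prop :=
  forall x : G, #|[set y | adj x y]| = d.

Definition has_walk (G : sgraph) (x y : G) (k : nat) : Prop :=
  exists p : seq G, [/\ path (@adj G) x p, last x p = y & size p = k].

Definition distance (G : sgraph) (x y : G) (k : nat) : Prop :=
  has_walk x y k /\ (forall l, has_walk x y l -> (k <= l)%N).

(* In particular a graph with a diameter is nonempty and connected. *)
Definition diameter (G : sgraph) (D : nat) : Prop :=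
  (forall x y : G, exists2 k, distance x y k & (k <= D)%N) /\
  (exists x y : G, distance x y D).

(* [ucycle] alone would also accept the empty sequence, and an edge traversed
   back and forth as a cycle of length 2. *)
Definition has_cycle (G : sgraph) (k : nat) : Prop :=
  exists c : seq G, [/\ ucycle (@adj G) c, (3 <= size c)%N & size c = k].

Definition girth (G : sgraph) (g : nat) : Prop :=
  has_cycle G g /\ (forall k, has_cycle G k -> (g <= k)%N).

Definition adjacency_mx (G : sgraph) : 'M[int]_#|G| :=
  \matrix_(i, j) (adj (enum_val i) (enum_val j))%:R.

(* The cyclic ordering of the (indices of the) vertices is s 0, ..., s (n-1);
   [ordS] is the successor modulo n. *)
Definition cycle_mx (n : nat) (B : 'M[int]_n) : Prop :=
  (3 <= n)%N /\
  exists s : 'S_n, forall k l : 'I_n,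
    B (s k) (s l) = ((l == ordS k) || (k == ordS l))%:R.

Fixpoint Gpoly (d m : nat) : {poly int} :=
  match m with
  | 0 => 1
  | m1.+1 =>
    match m1 with
    | 0 => 'X + 1
    | m2.+1 => 'X * Gpoly d m1 - (d%:R - 1) *: Gpoly d m2
    end
  end.

(* [horner_mx] is only available for sizes of the form n.+1, which #|G| is not
   syntactically; [mx_evalE] shows that the two agree. *)
Definition mx_eval (n : nat) (p : {poly int}) (A : 'M[int]_n) : 'M[int]_n :=
  \sum_(i < size p) p`_i *: A ^+ i.

Lemma mx_evalE (n : nat) (p : {poly int}) (A : 'M[int]_n.+1) :
  mx_eval p A = horner_mx A p.
Proof.
rewrite -{2}[p]coefK poly_def raddf_sum; apply: eq_bigr => i _ /=.
by rewrite linearZ rmorphXn /= horner_mx_X.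
Qed.

Definition cyclic_defect (G : sgraph) (d D : nat) : Prop :=
  [/\ (3 <= d)%N, (2 <= D)%N, regular G d, diameter G D
    & exists2 B : 'M[int]_#|G|, cycle_mx B
      & mx_eval (Gpoly d D) (adjacency_mx G) = const_mx 1 + B].

Definition cyclic_excess (G : sgraph) (d g : nat) : Prop :=
  [/\ (3 <= d)%N, odd g /\ (5 <= g)%N, regular G d, girth G g
    & exists2 B : 'M[int]_#|G|, cycle_mx B
      & mx_eval (Gpoly d g./2) (adjacency_mx G) = const_mx 1 - B].

(* Main.v *)
Require Import Defs.
From mathcomp Require Import all_boot all_order all_fingroup all_algebra.
From mathcomp Require Import zify ring.

Set Implicit Arguments.
Unset Strict Implicit.
Unset Printing Implicit Defensive.

Import GRing.Theory Num.Theory.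
Local Open Scope ring_scope.

(** Write [B = eps (G_m(A) - J)] with [eps = 1] (defect) or [-1] (excess), and
    index the vertices by Z/N along the cycle of [B]; [G_m(3) = N + 2 eps]
    shows that 4 divides N.  Since [A] commutes with [J], it commutes with [B],
    hence preserves the eigenspaces of [B].

    The eigenspace for [-2] is spanned by [(-1)^x], so [A] acts on it by some
    odd integer [t] with [|t| <= 3] and [G_m(t) = -2 eps].  Congruences modulo
    powers of 2 leave only [t = -1]: each vertex has exactly one neighbour at
    even cyclic distance.

    The kernel of [B] is the plane of functions with [f(x+2) = - f(x)], on
    which the symmetric matrix [A] acts as [[al, c], [c, al]] with [al = 1] or
    [-1] and [c] in [{-2, 0, 2}].  So one of [1], [-1], [3], [-3] is a root of
    [G_m], which the same congruences exclude, except that [G_2(1) = 0]; there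
    [N = 12] and [al = 1] would make the unique even neighbour [4] or [8] of
    vertex [0] come with its opposite.  *)

(** * Values of [Gpoly 3 m] at 3, -3, 1 and -1 *)

Lemma horner_Gpoly3_rec (m : nat) (t : int) :
  (Gpoly 3 m.+2).[t] = t * (Gpoly 3 m.+1).[t] - 2 * (Gpoly 3 m).[t].
Proof.
have -> : Gpoly 3 m.+2 = 'X * Gpoly 3 m.+1 - (3%:R - 1) *: Gpoly 3 m by [].
by rewrite hornerD hornerN hornerZ hornerM hornerX; congr (_ - _ * _).
Qed.

Lemma horner_Gpoly3_0 (t : int) : (Gpoly 3 0).[t] = 1.
Proof. by rewrite /= hornerE. Qed.

Lemma horner_Gpoly3_1 (t : int) : (Gpoly 3 1).[t] = t + 1.
Proof. by rewrite /= !hornerE. Qed.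

Lemma horner_Gpoly3_at_3 (m : nat) : (Gpoly 3 m).[3] = 3 * 2 ^+ m - 2.
Proof.
suff [] : (Gpoly 3 m).[3] = 3 * 2 ^+ m - 2
        /\ (Gpoly 3 m.+1).[3] = 3 * 2 ^+ m.+1 - 2 by [].
elim: m => [|m [IH0 IH1]]; first by rewrite horner_Gpoly3_0 horner_Gpoly3_1.
split=> //; rewrite horner_Gpoly3_rec IH0 IH1 !exprS; ring.
Qed.

Lemma horner_Gpoly3_at_m3 (m : nat) : (Gpoly 3 m).[-3] = (-2) ^+ m.
Proof.
suff [] : (Gpoly 3 m).[-3] = (-2) ^+ m
        /\ (Gpoly 3 m.+1).[-3] = (-2) ^+ m.+1 by [].
elim: m => [|m [IH0 IH1]]; first by rewrite horner_Gpoly3_0 horner_Gpoly3_1.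
split=> //; rewrite horner_Gpoly3_rec IH0 IH1 !exprS; ring.
Qed.

(** The residue 4 modulo 8 reproduces itself, as 4 - 2 * 4 = -4. It starts at index 3 because
    [Gpoly 3 2] vanishes at 1. *)
Lemma horner_Gpoly3_at_1 (m : nat) :
  exists k : int, (Gpoly 3 m.+3).[1] = 8 * k + 4.
Proof.
suff [k [k' [-> _]]] : exists k k' : int, (Gpoly 3 m.+3).[1] = 8 * k + 4
                            /\ (Gpoly 3 m.+4).[1] = 8 * k' + 4 by exists k.
elim: m => [|m [k [k' [IH0 IH1]]]].
  by exists (-1), (-1); rewrite !horner_Gpoly3_rec horner_Gpoly3_0 horner_Gpoly3_1.
exists k', (k' - 2 * k - 1); split=> //.
rewrite horner_Gpoly3_rec IH0 IH1; ring.
Qed.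

Lemma horner_Gpoly3_at_m1 (m : nat) :
  exists k : int, (Gpoly 3 m.+2).[-1] = 4 * k + 2.
Proof.
suff [k [k' [-> _]]] : exists k k' : int, (Gpoly 3 m.+2).[-1] = 4 * k + 2
                            /\ (Gpoly 3 m.+3).[-1] = 4 * k' + 2 by exists k.
elim: m => [|m [k [k' [IH0 IH1]]]].
  by exists (-1), 0; rewrite !horner_Gpoly3_rec horner_Gpoly3_0 horner_Gpoly3_1.
exists k', (- k' - 2 * k - 2); split=> //.
rewrite horner_Gpoly3_rec IH0 IH1; ring.
Qed.

(** * Eigenvectors and sums over a period *)

Lemma horner_mx_eigen (n : nat) (A : 'M[int]_n.+1) (v : 'cV_n.+1) (t : int)
    (p : {poly int}) :
  A *m v = t *: v -> horner_mx A p *m v = p.[t] *: v.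
Proof.
move=> Av; elim/poly_ind: p => [|p c IH].
  by rewrite rmorph0 horner0 mul0mx scale0r.
rewrite rmorphD rmorphM /= horner_mx_X horner_mx_C mulmxDl -mulmxE -mulmxA Av.
by rewrite -scalemxAr IH mul_scalar_mx scalerA -scalerDl !hornerE mulrC.
Qed.

Lemma sum_ord_shift (N : nat) (h : nat -> int) :
  (forall y, h (y + N)%N = h y) -> \sum_(y < N) h y.+1 = \sum_(y < N) h y.
Proof.
move=> hN; apply: (addrI (h 0%N)).
rewrite -(big_ord_recl N (fun i : 'I_N.+1 => h i)) big_ord_recr /=.
by have := hN 0%N; rewrite add0n => ->; rewrite addrC.
Qed.

(** * Cyclic labelling and commutation of [A] with [B] *)

Section CyclicCubicMatrix.

Variables (n m : nat) (A B : 'M[int]_n.+1) (s : 'S_n.+1) (eps : int).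
Hypothesis (n_ge2 : (2 <= n)%N).
Hypothesis (BE : forall k l : 'I_n.+1,
  B (s k) (s l) = ((l == ordS k) || (k == ordS l))%:R).
Hypothesis (A_sym : forall i j, A i j = A j i).
Hypothesis (A_diag : forall i, A i i = 0).
Hypothesis (A_ge0 : forall i j, 0 <= A i j).
Hypothesis (A_row : forall i, \sum_j A i j = 3).
Hypothesis (eps_sq : eps = 1 \/ eps = -1).
Hypothesis (GA : horner_mx A (Gpoly 3 m) = const_mx 1 + eps *: B).
Hypothesis (m_ge2 : (2 <= m)%N).
Hypothesis (m_ge3 : eps = 1 -> (3 <= m)%N).

Local Notation N := n.+1.
(** [inZp] reduces modulo [N], so [a] is periodic in both arguments and cyclic steps become
    successors in [nat]. *)
Let a (x y : nat) : int := A (s (inZp x)) (s (inZp y)).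

Let inZpD (x : nat) : inZp (x + N) = inZp x :> 'I_N.
Proof. by apply: val_inj; rewrite /= modnDr. Qed.

Let aNr (x y : nat) : a x (y + N) = a x y.
Proof. by rewrite /a inZpD. Qed.

Let aNl (x y : nat) : a (x + N) y = a x y.
Proof. by rewrite /a inZpD. Qed.

Let a_sym (x y : nat) : a x y = a y x.
Proof. exact: A_sym. Qed.

Let a_ge0 (x y : nat) : 0 <= a x y.
Proof. exact: A_ge0. Qed.

Lemma sum_cycle_mx (g : 'I_N -> int) (y : nat) :
  \sum_j g j * B (s j) (s (inZp y.+1)) = g (inZp y) + g (inZp y.+2).
Proof.
have inZpS (z : nat) : inZp z.+1 = ordS (inZp z : 'I_N).
  by apply: val_inj; rewrite /= -addn1 -modnDml addn1.
(* As [N] is at least 3, the two cyclic neighbours of [y.+1] are distinct. *)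
have ne : inZp y.+2 != inZp y :> 'I_N.
  apply/eqP => /(congr1 val) /= /eqP.
  by rewrite -[y in X in _ == X]addn0 -addn2 eqn_modDl !modn_small // ltnS.
rewrite (bigD1 (inZp y)) //= (bigD1 (inZp y.+2)) //= big1 ?addr0.
  by rewrite !BE -!inZpS !eqxx orbT !mulr1.
move=> j /andP[j1 j2]; rewrite BE -inZpS (negPf j2) orbF inZpS.
case: eqP => [/ordS_inj jE|_]; last by rewrite mulr0.
by rewrite jE eqxx in j1.
Qed.

Let B_sym (k l : 'I_N) : B (s k) (s l) = B (s l) (s k).
Proof. by rewrite !BE orbC. Qed.

Let AB : A *m B = B *m A.
Proof.
have AJ : A *m const_mx 1 = const_mx 1 *m A :> 'M_N.
  apply/matrixP => i j; rewrite !mxE.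
  transitivity (3 : int); last symmetry.
    by rewrite -(A_row i); apply: eq_bigr => k _; rewrite mxE mulr1.
  by rewrite -(A_row j); apply: eq_bigr => k _; rewrite mxE mul1r A_sym.
have AG : A *m horner_mx A (Gpoly 3 m) = horner_mx A (Gpoly 3 m) *m A.
  exact/comm_mx_sym/comm_horner_mx.
move: AG; rewrite GA mulmxDr mulmxDl AJ => /addrI.
rewrite -scalemxAr -scalemxAl.
by case: eps_sq => ->; rewrite ?scale1r // !scaleN1r => /oppr_inj.
Qed.

(** The entry of [AB] at [(x.+1, y.+1)]: a discrete wave equation. *)
Let a_wave (x y : nat) :
  a x.+1 y + a x.+1 y.+2 = a x y.+1 + a x.+2 y.+1.
Proof.
have /matrixP/(_ (s (inZp x.+1)) (s (inZp y.+1))) := AB.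
rewrite !mxE (reindex_inj (@perm_inj _ s)) [RHS](reindex_inj (@perm_inj _ s)) /=.
rewrite (sum_cycle_mx (fun j => A _ (s j))) => ->.
rewrite -(sum_cycle_mx (fun j => A (s j) (s (inZp y.+1)))).
by apply: eq_bigr => j _; rewrite mulrC B_sym.
Qed.

Let sum_row (x : nat) (f : nat -> int) (v : 'cV_N) :
  (forall y : 'I_N, v (s y) 0 = f y) ->
  (A *m v) (s (inZp x)) 0 = \sum_(y < N) a x y * f y.
Proof.
move=> vE; rewrite mxE (reindex_inj (@perm_inj _ s)) /=.
by apply: eq_bigr => y _; rewrite vE /a valZpK.
Qed.

(** Apply [GA] to the eigenvector [f]; reading the result at [x.+1] makes the cyclic neighbours [x]
    and [x.+2], with no predecessor to name. *)
Let Gpoly_eigen (f : nat -> int) (t : int) :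
  (forall y, f (y + N)%N = f y) ->
  (forall x, \sum_(y < N) a x y * f y = t * f x) ->
  forall x, \sum_(y < N) f y + eps * (f x + f x.+2) = (Gpoly 3 m).[t] * f x.+1.
Proof.
move=> fN fE x.
have f_mod y : f (y %% N)%N = f y.
  rewrite [in RHS](divn_eq y N) addnC.
  by elim: (y %/ N)%N => [|k IH]; rewrite ?addn0 // mulSn addnCA addnC fN.
pose v : 'cV[int]_N := \col_i f (s^-1%g i).
have vE y : v (s y) 0 = f y by rewrite mxE permK.
have Av : A *m v = t *: v.
  apply/matrixP => i j; rewrite ord1 -(permKV s i) -[(s^-1)%g i]valZpK.
  by rewrite (sum_row _ vE) fE !mxE permK /= f_mod.
have := horner_mx_eigen (Gpoly 3 m) Av.
rewrite GA mulmxDl => /matrixP/(_ (s (inZp x.+1)) 0).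
rewrite [LHS]mxE [RHS]mxE vE /= f_mod => <-; congr (_ + _).
  rewrite mxE [RHS](reindex_inj (@perm_inj _ s)).
  by apply: eq_bigr => y _; rewrite vE mxE mul1r.
rewrite -scalemxAl mxE; congr (_ * _).
rewrite mxE [RHS](reindex_inj (@perm_inj _ s)) /=.
rewrite -(f_mod x) -(f_mod x.+2).
rewrite -(sum_cycle_mx (fun j : 'I_N => f j)).
by apply: eq_bigr => j _; rewrite vE mulrC B_sym.
Qed.


(** * Neighbour counts by residue modulo 4 *)

Let I4 (r y : nat) : int := (y %% 4 == r)%N%:R.
Let T (x r : nat) : int := \sum_(y < N) a x y * I4 r y.

Let I4_sum (y : nat) : I4 0 y + I4 1 y + I4 2 y + I4 3 y = 1.
Proof.
rewrite /I4; have := ltn_pmod y (isT : 0 < 4)%N.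
by case: (y %% 4)%N => [|[|[|[|]]]].
Qed.

Let I4S (y : nat) : [/\ I4 0 y.+1 = I4 3 y, I4 1 y.+1 = I4 0 y,
  I4 2 y.+1 = I4 1 y & I4 3 y.+1 = I4 2 y].
Proof.
rewrite /I4 -addn1 -modnDml; have := ltn_pmod y (isT : 0 < 4)%N.
by case: (y %% 4)%N => [|[|[|[|]]]].
Qed.

Let a_row (x : nat) : \sum_(y < N) a x y = 3.
Proof.
rewrite -(A_row (s (inZp x))) [RHS](reindex_inj (@perm_inj _ s)) /=.
by apply: eq_bigr => y _; rewrite /a valZpK.
Qed.

Let order_eq : N%:R + 2 * eps = 3 * 2 ^+ m - 2 :> int.
Proof.
have row1 x : \sum_(y < N) a x y * 1 = 3 * 1.
  by under eq_bigr => y _ do rewrite mulr1; rewrite a_row.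
have := Gpoly_eigen (f := fun=> 1) (fun=> erefl) row1 0.
by rewrite horner_Gpoly3_at_3 sumr_const card_ord !mulr1 => <-; rewrite mulrC.
Qed.

Let order4 : exists k, N = (4 * k)%N.
Proof.
have [k mE] : exists k, m = k.+2 by exists m.-2; lia.
move: order_eq; rewrite mE !exprS -natrX.
by case: eps_sq => -> oE; [exists (3 * 2 ^ k - 1)%N|exists (3 * 2 ^ k)%N]; lia.
Qed.

Let T_ge0 (x r : nat) : 0 <= T x r.
Proof. by apply: sumr_ge0 => y _; rewrite mulr_ge0 // /I4; case: (_ == _). Qed.

Let T_sum (x : nat) : T x 0 + T x 1 + T x 2 + T x 3 = 3.
Proof.
rewrite /T -!big_split /= -(a_row x); apply: eq_bigr => y _.
by rewrite -!mulrDr I4_sum mulr1.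
Qed.

Let per4 (f : nat -> int) :
  (forall y, f y.+4 = f y) -> forall y, f (y + N)%N = f y.
Proof.
have [k ->] := order4 => f4 y; elim: k => [|k IH]; first by rewrite muln0 addn0.
by rewrite mulnS addnCA addnC addn4 f4.
Qed.

Let I4_4 (r y : nat) : I4 r y.+4 = I4 r y.
Proof. by rewrite /I4 -addn4 modnDr. Qed.

(** This is [B A f = A B f] read at [x.+1]; [y.+3] stands for the predecessor of [y], since [f] has
    period 4. *)
Let wave_sum (f : nat -> int) (x : nat) : (forall y, f y.+4 = f y) ->
  \sum_(y < N) a x y * f y + \sum_(y < N) a x.+2 y * f y =
  \sum_(y < N) a x.+1 y * f y.+1 + \sum_(y < N) a x.+1 y * f y.+3.
Proof.
move=> f4; have fN := per4 f4.
have shift z := sum_ord_shift (h := fun y => a z y * f y)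
  (fun y => congr2 *%R (aNr z y) (fN y)).
rewrite -!shift.
rewrite -(sum_ord_shift (h := fun y => a x.+1 y * f y.+3)); last first.
  by move=> y; rewrite aNr -addSn -addSn -addSn fN.
rewrite -(sum_ord_shift (h := fun y => a x.+1 y.+1 * f y.+4)); last first.
  by move=> y; rewrite -addSn aNr -!addSn fN.
rewrite -!big_split /=; apply: eq_bigr => y _.
by rewrite f4 -!mulrDl a_wave.
Qed.

Let T_wave (x : nat) : [/\ T x 0 + T x.+2 0 = T x.+1 3 + T x.+1 1,
  T x 1 + T x.+2 1 = T x.+1 0 + T x.+1 2,
  T x 2 + T x.+2 2 = T x.+1 1 + T x.+1 3 &
  T x 3 + T x.+2 3 = T x.+1 2 + T x.+1 0].
Proof.
have S3 y : [/\ I4 0 y.+3 = I4 1 y, I4 1 y.+3 = I4 2 y,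
  I4 2 y.+3 = I4 3 y & I4 3 y.+3 = I4 0 y].
  have [e0 e1 e2 e3] := I4S y; have [f0 f1 f2 f3] := I4S y.+1.
  by have [-> -> -> ->] := I4S y.+2; split; congruence.
split; rewrite /T (wave_sum _ (I4_4 _)); congr (_ + _); apply: eq_bigr => y _;
  by have [e0 e1 e2 e3] := I4S y; have [f0 f1 f2 f3] := S3 y; congr (_ * _).
Qed.

(** With e(x) = [T x 0 + T x 2], [T_wave] and [T_sum] give e(x) + 2 e(x+1) + e(x+2) = 6, so (-1)^x
    (e(x) - 3/2) is an arithmetic progression with integer step. From [x] to [x.+4] it takes four
    steps but moves by at most 3, since e lies between 0 and 3; hence the step is 0. *)
Let even_alternate (x : nat) : T x 0 + T x 2 + (T x.+1 0 + T x.+1 2) = 3.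
Proof.
have [e0 e1 e2 e3] := T_wave x; have [f0 f1 f2 f3] := T_wave x.+1.
have [g0 g1 g2 g3] := T_wave x.+2.
move: (T_sum x) (T_sum x.+1) (T_sum x.+2) (T_sum x.+3) (T_sum x.+4).
move: (T_ge0 x 0) (T_ge0 x 1) (T_ge0 x 2) (T_ge0 x 3).
move: (T_ge0 x.+4 0) (T_ge0 x.+4 1) (T_ge0 x.+4 2) (T_ge0 x.+4 3).
lia.
Qed.

(** By [a_wave] the increment [a z.+1 y.+1 - a z y] is constant along antidiagonals. The
    antidiagonal through [(x, x + j.*2)] meets the main diagonal, where [a] vanishes. *)
Let even_shift (x j : nat) : a x.+1 (x + j.*2).+1 = a x (x + j.*2)%N.
Proof.
have diff y i z : a z.+1 (y + i).+1 - a z (y + i)%N =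
                  a (z + i).+1 y.+1 - a (z + i)%N y.
  elim: i y z => [|i IH] y z; first by rewrite !addn0.
  have := IH y z.+1; rewrite addSnnS => <-; have := a_wave z (y + i)%N.
  rewrite addnS; lia.
have := diff (x + j)%N j x; rewrite -addnA addnn !/a !A_diag subrr.
by move/eqP; rewrite subr_eq0 => /eqP.
Qed.

(** * The alternating eigenvector *)

Let chi (y : nat) : int := I4 0 y - I4 1 y + I4 2 y - I4 3 y.
(** [u] and [w] are the cosine and sine of a quarter turn times [y]; they span the kernel of [B]. *)
Let u (y : nat) : int := I4 0 y - I4 2 y.
Let w (y : nat) : int := I4 1 y - I4 3 y.

Let chiS (y : nat) : chi y.+1 = - chi y.
Proof. rewrite /chi; have [-> -> -> ->] := I4S y; ring. Qed.

Let uS (y : nat) : u y.+1 = - w y.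
Proof. rewrite /u /w; have [-> _ -> _] := I4S y; ring. Qed.

Let wS (y : nat) : w y.+1 = u y.
Proof. by rewrite /u /w; have [_ -> _ ->] := I4S y. Qed.

Let T_chi (x : nat) :
  \sum_(y < N) a x y * chi y = (2 * (T 0 0 + T 0 2) - 3) * chi x.
Proof.
have -> : \sum_(y < N) a x y * chi y = 2 * (T x 0 + T x 2) - 3.
  transitivity (T x 0 - T x 1 + T x 2 - T x 3); last by have := T_sum x; lia.
  rewrite /T -!sumrN -!big_split /=.
  by apply: eq_bigr => y _; rewrite /chi; ring.
elim: x => [|x IH]; first by rewrite mulr1.
by rewrite chiS mulrN -IH; have := even_alternate x; lia.
Qed.

Let even_count : T 0 0 + T 0 2 = 1.
Proof.
have chi4 y : chi y.+4 = chi y by rewrite !chiS !opprK.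
have := Gpoly_eigen (per4 chi4) T_chi 0.
have -> : \sum_(y < N) chi y = 0.
  have := sum_ord_shift (per4 chi4).
  under eq_bigr => y _ do rewrite chiS.
  by rewrite sumrN; move: (\sum_(y < N) _) => S; lia.
rewrite !chiS opprK {1 2 3}/chi /I4 /=.
set E := T 0 0 + T 0 2 => GE.
have [E0 E3] : 0 <= E /\ E <= 3.
  move: (T_sum 0) (T_ge0 0 0) (T_ge0 0 1) (T_ge0 0 2) (T_ge0 0 3).
  by rewrite /E; lia.
have [k mE k0] : exists2 k : nat, m = k.+2 & (0 < 2 ^ k)%N.
  by exists m.-2; rewrite ?expn_gt0 //; lia.
(* [GE] amounts to G(2E - 3) = -2 eps. At -3 and 1 the value of G is divisible by 4; at 3 it is at
   least 10. *)
have [E_0|[E_1|[E_2|E_3]]] : E = 0 \/ (E = 1 \/ (E = 2 \/ E = 3)) by lia.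
- move: GE; rewrite E_0 horner_Gpoly3_at_m3 mE !exprS; move: (_ ^+ k) => z.
  by case: eps_sq => ->; lia.
- by [].
- move: GE; rewrite E_2.
  case: k mE k0 => [|k] mE _.
    rewrite mE horner_Gpoly3_rec horner_Gpoly3_0 horner_Gpoly3_1.
    by have := m_ge3; rewrite mE; case: eps_sq => ->; lia.
  have [j] := horner_Gpoly3_at_1 k; rewrite mE /= => ->.
  by case: eps_sq => ->; lia.
- move: GE; rewrite E_3 horner_Gpoly3_at_3 mE !exprS -natrX.
  by case: eps_sq => ->; lia.
Qed.

(** * Action of [A] on the kernel of [B] *)

Let uw_expand (h : nat -> int) :
  (forall x, h x.+2 = - h x) -> forall x, h x = h 0%N * u x + h 1%N * w x.
Proof.
move=> h2 x; suff [] : h x = h 0%N * u x + h 1%N * w x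
  /\ h x.+1 = h 0%N * u x.+1 + h 1%N * w x.+1 by [].
elim: x => [|x [IH0 IH1]]; first by rewrite /u /w /I4 /=; split; lia.
split=> //; rewrite h2 IH0 !(uS, wS); ring.
Qed.

(** [P] and [Q] are the images of [u] and [w] under [A]; their values at 0 and 1 are the entries of
    [A] on the kernel. *)
Let P (x : nat) : int := T x 0 - T x 2.
Let Q (x : nat) : int := T x 1 - T x 3.

Let P_sum (x : nat) : \sum_(y < N) a x y * u y = P x.
Proof. by rewrite /P /T -sumrB; apply: eq_bigr => y _; rewrite -mulrBr. Qed.

Let Q_sum (x : nat) : \sum_(y < N) a x y * w y = Q x.
Proof. by rewrite /Q /T -sumrB; apply: eq_bigr => y _; rewrite -mulrBr. Qed.

Let P_expand (x : nat) : P x = P 0 * u x + P 1 * w x.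
Proof. by apply: uw_expand => z; rewrite /P; have [] := T_wave z; lia. Qed.

Let Q_expand (x : nat) : Q x = Q 0 * u x + Q 1 * w x.
Proof. by apply: uw_expand => z; rewrite /Q; have [] := T_wave z; lia. Qed.

Let T_even_shift (r : nat) : (r < 3)%N -> ~~ odd r -> T 1 r.+1 = T 0 r.
Proof.
move=> r3 r_even; rewrite /T.
rewrite -(sum_ord_shift (h := fun y => a 1 y * I4 r.+1 y)); last first.
  by move=> y; rewrite aNr (per4 (I4_4 _)).
apply: eq_bigr => y _.
have -> : I4 r.+1 y.+1 = I4 r y.
  by move: r r3 {r_even} => [|[|[|]]] // _; have [] := I4S y.
case y4: (y %% 4 == r)%N; last by rewrite /I4 y4 !mulr0.
(* Only [y] congruent to the even number [r] modulo 4 contribute, so [y] is even and [even_shift]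
   applies. *)
have yE : nat_of_ord y = (0 + (y./2).*2)%N.
  rewrite add0n; apply/esym/even_halfK.
  by rewrite -(odd_mod y (erefl : odd 4 = false)) (eqP y4).
by rewrite yE even_shift.
Qed.

Let PQ_diag : P 0 = Q 1.
Proof. by rewrite /P /Q !T_even_shift. Qed.

(** Symmetry of [A] equates the products of [w] with [A u] and of [u] with [A w]; [u] and [w] are
    orthogonal and have the same nonzero norm. *)
Let PQ_offdiag : P 1 = Q 0.
Proof.
have uw0 y : u y * w y = 0.
  rewrite /u /w /I4; have := ltn_pmod y (isT : 0 < 4)%N.
  by case: (y %% 4)%N => [|[|[|[|]]]].
have e1 : \sum_(x < N) w x * P x = P 1 * \sum_(x < N) w x ^+ 2.
  rewrite big_distrr /=; apply: eq_bigr => x _.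
  by rewrite P_expand mulrDr mulrCA [w x * u x]mulrC uw0; ring.
have e2 : \sum_(x < N) u x * Q x = Q 0 * \sum_(x < N) u x ^+ 2.
  rewrite big_distrr /=; apply: eq_bigr => x _.
  by rewrite Q_expand mulrDr [u x * (Q 1 * _)]mulrCA uw0; ring.
have w4 y : w y.+4 = w y by rewrite !(wS, uS) opprK.
have wu : \sum_(x < N) w x ^+ 2 = \sum_(x < N) u x ^+ 2.
  rewrite -(sum_ord_shift (h := fun y => w y ^+ 2)).
    by apply: eq_bigr => x _; rewrite wS.
  by move=> y; rewrite (per4 w4).
have u_gt0 : 0 < \sum_(x < N) u x ^+ 2.
  rewrite big_ord_recl; apply: ltr_pwDl => //.
  by apply: sumr_ge0 => x _; apply: sqr_ge0.
have e3 : \sum_(x < N) w x * P x = \sum_(x < N) u x * Q x.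
  under eq_bigr => x _ do rewrite -P_sum big_distrr.
  rewrite exchange_big; apply: eq_bigr => x _; rewrite -Q_sum big_distrr.
  by apply: eq_bigr => y _ /=; rewrite (a_sym y x); ring.
apply: (mulIf (lt0r_neq0 u_gt0)).
by rewrite -e2 -e3 e1 wu.
Qed.

(** Here [u + z w] is an eigenvector of [A]. It has sum zero and lies in the kernel of [B], so G(A)
    annihilates it. *)
Let Gpoly_root (z : int) : z * z = 1 \/ z = 0 /\ P 1 = 0 ->
  (Gpoly 3 m).[P 0 + z * P 1] = 0.
Proof.
move=> zP; pose f y := u y + z * w y.
have f2 y : f y.+2 = - f y by rewrite /f !(uS, wS); ring.
have f4 y : f y.+4 = f y by rewrite !f2 opprK.
have f_eigen x : \sum_(y < N) a x y * f y = (P 0 + z * P 1) * f x.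
  transitivity (P x + z * Q x).
    rewrite -P_sum -Q_sum big_distrr -big_split /=.
    by apply: eq_bigr => y _; rewrite /f; ring.
  rewrite P_expand Q_expand -PQ_diag -PQ_offdiag /f.
  case: zP => [zz|[-> ->]]; last by ring.
  have -> : (P 0 + z * P 1) * (u x + z * w x) =
    P 0 * u x + z * P 1 * u x + z * P 0 * w x + (z * z) * P 1 * w x by ring.
  rewrite zz; ring.
(* The choice 3 reads the identity at 4, where [f] is 1. *)
have := Gpoly_eigen (per4 f4) f_eigen 3.
have -> : \sum_(y < N) f y = 0.
  have fN := per4 f4.
  have := sum_ord_shift (h := fun y => f y.+1) (fun y => fN y.+1).
  rewrite /= (sum_ord_shift fN).
  under eq_bigr => y _ do rewrite f2.
  by rewrite sumrN; move: (\sum_(y < N) _) => S; lia.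
rewrite !f2 /f /u /w /I4 /=; lia.
Qed.

(** * Exclusion of the possible roots *)

Let not_order_12 : m = 2%N -> P 0 = 1 -> False.
Proof.
(* [m_ge3] forces [eps = -1], and [order_eq] reads N - 2 = 10. *)
move=> m2; have NE : N = 12%N.
  move: order_eq; rewrite m2; have := m_ge3; rewrite m2.
  by case: eps_sq => ->; lia.
have expand (F : nat -> int) M : M = 12%N -> \sum_(y < M) F y =
  F 0 + F 1 + F 2 + F 3 + F 4 + F 5 + F 6 + F 7 + F 8 + F 9 + F 10 + F 11.
  by move=> ->; rewrite !big_ord_recr big_ord0 /= add0r.
have T0 : T 0 0 = a 0 4 + a 0 8.
  rewrite /T (expand (fun y => a 0 y * I4 0 y) _ NE) /I4 /= /a A_diag; ring.
(* Four shifts carry the pair (0, 8) to (4, 12), which is (4, 0) modulo 12; [T 0 0] is then even,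
   yet must be 1. *)
have a48 : a 0 8 = a 0 4.
  have := (even_shift 0 4, even_shift 1 4, even_shift 2 4, even_shift 3 4).
  case=> [[[<- <-] <-] <-]; rewrite a_sym.
  by rewrite -[(3 + 4.*2).+1]/(0 + 12)%N -NE aNl.
by move: even_count; rewrite /P T0 a48; lia.
Qed.

Lemma no_cubic_cyclic_matrix : False.
Proof.
(* An even total makes the difference [P 1] even. *)
have c3 : T 1 0 + T 1 2 = 2 by have := even_alternate 0; rewrite even_count; lia.
have P1 : P 1 = 0 \/ (P 1 = 2 \/ P 1 = -2).
  by move: (T_ge0 1 0) (T_ge0 1 2); rewrite /P; lia.
have P0 : P 0 = 1 \/ P 0 = -1.
  by move: (T_ge0 0 0) (T_ge0 0 2) even_count; rewrite /P; lia.
have Gm1 : (Gpoly 3 m).[-1] <> 0.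
  by case: m m_ge2 => [|[|k]] // _; have [j ->] := horner_Gpoly3_at_m1 k; lia.
have Gm3 : (Gpoly 3 m).[-3] <> 0.
  by rewrite horner_Gpoly3_at_m3; apply/eqP; rewrite expf_neq0.
have G1 : P 0 = 1 -> (Gpoly 3 m).[1] <> 0.
  case: m m_ge2 not_order_12 => [|[|[|k]]] // _ no12; first by move=> /no12.
  by have [j ->] := horner_Gpoly3_at_1 k; lia.
case: P1 => [P10|P1].
  have := @Gpoly_root 0; rewrite P10 mulr0 addr0 => root.
  case: P0 => P0; rewrite P0 in root; [apply: G1 => //|apply: Gm1];
    by apply: root; right.
have rootp : (Gpoly 3 m).[P 0 + P 1] = 0.
  by rewrite -[P 1]mul1r Gpoly_root //; left.
have rootm : (Gpoly 3 m).[P 0 - P 1] = 0.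
  by rewrite -mulN1r Gpoly_root //; left.
(* For [P 0 = 1] one of [P 0 + P 1], [P 0 - P 1] is -1; for [P 0 = -1] one of them is -3. *)
case: P0 => P0; case: P1 => P1; rewrite P0 P1 in rootp rootm.
- exact: Gm1 rootm.
- exact: Gm1 rootp.
- exact: Gm3 rootm.
- exact: Gm3 rootp.
Qed.

End CyclicCubicMatrix.

(** * From graphs to matrices *)

Lemma no_cubic_cyclic_sgraph (G : sgraph) (m : nat) (eps : int)
    (B : 'M[int]_#|G|) :
  regular G 3 -> cycle_mx B -> eps = 1 \/ eps = -1 ->
  (2 <= m)%N -> (eps = 1 -> 3 <= m)%N ->
  mx_eval (Gpoly 3 m) (adjacency_mx G) = const_mx 1 + eps *: B -> False.
Proof.
move=> G_reg B_cyc eps_sq m2 m3.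
have A_sym i j : adjacency_mx G i j = adjacency_mx G j i.
  by rewrite !mxE adj_sym.
have A_diag i : adjacency_mx G i i = 0 by rewrite mxE adj_irr.
have A_ge0 i j : 0 <= adjacency_mx G i j by rewrite mxE ler0n.
have A_row i : \sum_j adjacency_mx G i j = 3.
  rewrite -[RHS](congr1 (fun k => k%:R) (G_reg (enum_val i))).
  rewrite -sum1_card natr_sum [RHS]big_mkcond /=.
  rewrite [RHS](reindex _ (onW_bij _ (enum_val_bij G))) /=.
  by apply: eq_bigr => j _; rewrite mxE inE; case: (adj _ _).
(* Generalizing over the matrices lets [#|G|] become a successor, as [mx_evalE] requires. *)
move: (adjacency_mx G) B B_cyc A_sym A_diag A_ge0 A_row.
case: #|G| => [|n] A B [// n3 [s BE]] A_sym A_diag A_ge0 A_row.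
rewrite mx_evalE => GA.
exact: (no_cubic_cyclic_matrix n3 BE A_sym A_diag A_ge0 A_row eps_sq GA m2 m3).
Qed.

Theorem theorem12 :
  (forall D : nat, 3 <= D -> forall G : sgraph, ~ cyclic_defect G 3 D)%N /\
  (forall g : nat, odd g -> 5 <= g -> forall G : sgraph, ~ cyclic_excess G 3 g)%N.
Proof.
split=> [D D3 G [_ D2 G_reg _ [B B_cyc GA]]|g _ g5 G [_ _ G_reg _ [B B_cyc GA]]].
  by apply: (@no_cubic_cyclic_sgraph G D 1 B) => //; [left|rewrite scale1r].
apply: (@no_cubic_cyclic_sgraph G g./2 (-1) B) => //.
- by right.
- by lia.
- by rewrite scaleN1r.
Qed.
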